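(* Let $t,p$ be $\lambda$-terms, $k$ a natural number and $e$ an integer such that $t\xrightarrow{(e)}{}_{mx}^{k}\,p$ and $\mathrm{normal}_{mx}(p)$. Then there exist a typing context $\Gamma$, a type $\tau$ and an mx-tight derivation (in system $mx$) of $\Gamma\vdash^{(2k,\,|p|_{mx}+e)}t:\tau$. Moreover, if $\mathrm{neutral}_{mx}(p)$ then $\tau=\mathtt{neutral}$, and if $\mathrm{abs}_{mx}(p)$ then $\tau=\mathtt{abs}$.
   Context: Terms are $\lambda$-terms $t,p,u,q::=x\mid\lambda x.t\mid t\,p$, up to $\alpha$-equivalence; $t\{x\leftarrow p\}$ is capture-avoiding substitution, $\mathrm{fv}(t)$ the set of free variables. $\mathrm{abs}_{mx}(t)$ holds iff $t$ is an abstraction. Predicates (inductive): $\mathrm{neutral}_{mx}(x)$; $\mathrm{neutral}_{mx}(t\,p)$ if $\mathrm{neutral}_{mx}(t)$ and $\mathrm{normal}_{mx}(p)$; $\mathrm{normal}_{mx}(t)$ if $\mathrm{neutral}_{mx}(t)$; $\mathrm{normal}_{mx}(\lambda y.t)$ if $\mathrm{normal}_{mx}(t)$. Size: $|x|_{mx}=0$, $|\lambda x.p|_{mx}=|p|_{mx}+1$, $|p\,u|_{mx}=|p|_{mx}+|u|_{mx}+1$. Maximal strategy $t\xrightarrow{(e)}_{mx}p$, indexed by an integer $e$ (size of what is erased), inductively: $(\lambda x.u)q\xrightarrow{(0)}_{mx}u\{x\leftarrow q\}$ if $x\in\mathrm{fv}(u)$; $(\lambda x.u)q\xrightarrow{(|q|_{mx})}_{mx}u$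 if $\mathrm{normal}_{mx}(q)$ and $x\notin\mathrm{fv}(u)$; $(\lambda x.u)t\xrightarrow{(e)}_{mx}(\lambda x.u)p$ if $t\xrightarrow{(e)}_{mx}p$ and $x\notin\mathrm{fv}(u)$; $\lambda x.t\xrightarrow{(e)}_{mx}\lambda x.p$ if $t\xrightarrow{(e)}_{mx}p$; $t\,u\xrightarrow{(e)}_{mx}p\,u$ if not $\mathrm{abs}_{mx}(t)$ and $t\xrightarrow{(e)}_{mx}p$; $u\,t\xrightarrow{(e)}_{mx}u\,p$ if $\mathrm{neutral}_{mx}(u)$ and $t\xrightarrow{(e)}_{mx}p$. Iteration: $t\xrightarrow{(0)}{}_{mx}^{0}t$; and $t\xrightarrow{(e_1+e_2)}{}_{mx}^{k+1}u$ if $t\xrightarrow{(e_1)}_{mx}p$ and $p\xrightarrow{(e_2)}{}_{mx}^{k}u$. Types: tight constants are $\mathtt{neutral}$ and $\mathtt{abs}$ (generically $\mathtt{tight}$); types are $\tau,\sigma::=\mathtt{tight}\mid X\mid M\to\tau$, with $X$ in a non-empty set of atomic types; $M::=[\tau_i]_{i\in I}$ ($I$ finite) are finite multisets of types, $[\,]$ the empty one. A type is tight if it is a tight constant; a multiset is tight if all its elements are. A typing context $\Gamma$ maps variables to multisets, all but finitely many to $[\,]$; it is tight if every $\Gamma(x)$ is tight. $\uplus$ is multiset union, extended pointwise to contexts. $\Gamma\setminus\!\!\setminus x$ is $\Gamma$ with $x$ reset to $[\,]$. $x:M$ denotes the context mapping $x$ to $M$ and other variables to $[\,]$. Typing rules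 of system $mx$: (ax) $x:[\tau]\vdash^{(0,0)}x:\tau$. (fun$_b$) from $\Gamma\vdash^{(b,r)}t:\tau$ infer $\Gamma\setminus\!\!\setminus x\vdash^{(b+1,r)}\lambda x.t:\Gamma(x)\to\tau$. (fun$_r$) from $\Gamma\vdash^{(b,r)}t:\mathtt{tight}$ with $\Gamma(x)$ tight infer $\Gamma\setminus\!\!\setminus x\vdash^{(b,r+1)}\lambda x.t:\mathtt{abs}$. (app$_b$) from $\Gamma\vdash^{(b,r)}t:M\to\tau$ and $\Delta\vdash^{(b',r')}p:M$ infer $\Gamma\uplus\Delta\vdash^{(b+b'+1,r+r')}t\,p:\tau$. (app$_r$) from $\Gamma\vdash^{(b,r)}t:\mathtt{neutral}$ and $\Delta\vdash^{(b',r')}p:\mathtt{tight}$ infer $\Gamma\uplus\Delta\vdash^{(b+b',r+r'+1)}t\,p:\mathtt{neutral}$. (many$_{>0}$) from $(\Delta_i\vdash^{(b_i,r_i)}t:\tau_i)_{i\in I}$ with $I$ finite and non-empty infer $\uplus_{i\in I}\Delta_i\vdash^{(\sum_i b_i,\sum_i r_i)}t:[\tau_i]_{i\in I}$. (none) from $\Delta\vdash^{(b,r)}t:\tau$ ($\tau$ a type) infer $\Delta\vdash^{(b,r)}t:[\,]$. A derivation is garbage-tight if in every instance of rule (none) in it the premise's type $\tau$ is tight. A derivation of $\Gamma\vdash^{(b,r)}t:\tau$ is mx-tight if it is garbage-tight and moreover $\tau$ and $\Gamma$ are tight. *)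

(* Defs.v *)
From HB Require Import structures.
From mathcomp Require Import all_boot all_order all_algebra.
From mathcomp Require Import finmap multiset.
From mathcomp Require Import boolp.

Set Implicit Arguments.
Unset Strict Implicit.
Unset Printing Implicit Defensive.

Import GRing.Theory.

Local Open Scope fset_scope.
Local Open Scope mset_scope.
Local Open Scope nat_scope.

(** Terms up to alpha-equivalence, with de Bruijn indices: index [x] under [n] binders refers to the free
    variable [x - n] when [n <= x]. *)

Inductive term : Type :=
| Var (x : nat)
| Lam (t : term)
| App (t p : term).

Fixpoint in_fv (x : nat) (t : term) : bool :=
  match t with
  | Var y => x == y
  | Lam t => in_fv x.+1 t
  | App t p => in_fv x t || in_fv x p
  end.

Fixpoint shift (c : nat) (t : term) : term :=
  match t with
  | Var x => Var (if c <= x then x.+1 else x)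
  | Lam t => Lam (shift c.+1 t)
  | App t p => App (shift c t) (shift c p)
  end.

(** [subst c q t] replaces index [c] by [q] and decrements the indices above
    [c], since the binder of [c] disappears: for the body [u] of [Lam u], the
    term [subst 0 q u] is u{x <- q}. *)
Fixpoint subst (c : nat) (q t : term) : term :=
  match t with
  | Var x => if x < c then Var x else if x == c then q else Var x.-1
  | Lam t => Lam (subst c.+1 (shift 0 q) t)
  | App t p => App (subst c q t) (subst c q p)
  end.

Definition abs_mx (t : term) : Prop := exists u, t = Lam u.

Inductive neutral_mx : term -> Prop :=
| neutral_var x : neutral_mx (Var x)
| neutral_app t p : neutral_mx t -> normal_mx p -> neutral_mx (App t p)
with normal_mx : term -> Prop :=
| normal_neutral t : neutral_mx t -> normal_mx t
| normal_lam t : normal_mx t -> normal_mx (Lam t).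

Fixpoint size_mx (t : term) : nat :=
  match t with
  | Var _ => 0
  | Lam p => (size_mx p).+1
  | App p u => (size_mx p + size_mx u).+1
  end.

(** In [mx_erase] the bound variable does not occur in [u], so the reduct
    [subst 0 q u] does not contain [q]: it is [u] itself, with its indices
    decremented because it is no longer under the binder. *)
Inductive step_mx : int -> term -> term -> Prop :=
| mx_beta u q :
    in_fv 0 u -> step_mx 0%R (App (Lam u) q) (subst 0 q u)
| mx_erase u q :
    normal_mx q -> ~~ in_fv 0 u ->
    step_mx (size_mx q)%:Z%R (App (Lam u) q) (subst 0 q u)
| mx_arg e u t p :
    step_mx e t p -> ~~ in_fv 0 u ->
    step_mx e (App (Lam u) t) (App (Lam u) p)
| mx_lam e t p :
    step_mx e t p -> step_mx e (Lam t) (Lam p)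
| mx_appl e t p u :
    ~ abs_mx t -> step_mx e t p -> step_mx e (App t u) (App p u)
| mx_appr e u t p :
    neutral_mx u -> step_mx e t p -> step_mx e (App u t) (App u p).

Inductive steps_mx : nat -> int -> term -> term -> Prop :=
| mx_refl t : steps_mx 0 0%R t t
| mx_step k e1 e2 t p u :
    step_mx e1 t p -> steps_mx k e2 p u -> steps_mx k.+1 (e1 + e2)%R t u.

(** Types contain finite multisets of types.  Raw types have lists instead;
    types are raw types modulo reordering of these lists at every depth,
    represented by the raw types that are fixed by [canon].  The lemmas
    [arr_inj], [arr_neq_atom], [arr_neq_tight] etc. and [ty_ind] show that
    [ty X] is freely generated by [tight], [atom] and
    [arr : {mset ty X} -> ty X -> ty X]. *)

Inductive tight_const : Type := tneutral | tabs.

Inductive rawty (X : Type) : Type :=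
| RTight (c : tight_const)
| RAtom (x : X)
| RArr (M : seq (rawty X)) (s : rawty X).

HB.instance Definition _ (X : Type) := gen_eqMixin (rawty X).
HB.instance Definition _ (X : Type) := gen_choiceMixin (rawty X).

Section Types.
Variable X : Type.

(** [choose (perm_eq s) s] is a representative of the permutation class of
    [s] that only depends on this class. *)
Definition canon_seq (s : seq (rawty X)) : seq (rawty X) :=
  choose (perm_eq s) s.

Fixpoint canon (t : rawty X) : rawty X :=
  match t with
  | RArr M s => RArr (canon_seq (map canon M)) (canon s)
  | _ => t
  end.

Fixpoint rawty_size (t : rawty X) : nat :=
  match t with
  | RArr M s => (sumn (map rawty_size M) + rawty_size s).+1
  | _ => 0
  end.

Lemma rawty_ind' (P : rawty X -> Prop) :
  (forall c, P (RTight X c)) -> (forall x, P (RAtom x)) ->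
  (forall M s, (forall t, t \in M -> P t) -> P s -> P (RArr M s)) ->
  forall t, P t.
Proof.
move=> Pc Px PM t; move: {2}(rawty_size t) (leqnn (rawty_size t)) => n.
elim: n t => [|n IH] [c|x|M s] //= le_n.
apply: PM => [t tM|]; apply: IH; last exact: leq_trans (leq_addl _ _) le_n.
apply: leq_trans (leq_trans (leq_addr _ _) le_n).
elim: M tM {le_n} => //= a M IHM; rewrite inE => /orP[/eqP->|/IHM tM].
  exact: leq_addr.
exact: leq_trans tM (leq_addl _ _).
Qed.

Lemma canon_seqP s : perm_eq s (canon_seq s).
Proof. exact: (chooseP (perm_refl s)). Qed.

Lemma canon_seq_perm s1 s2 : perm_eq s1 s2 -> canon_seq s1 = canon_seq s2.
Proof.
move=> s12; rewrite /canon_seq.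
have e : perm_eq s1 =1 perm_eq s2 by move=> s; rewrite (permPl s12).
by rewrite (eq_choose e); apply: choose_id => //; rewrite perm_sym.
Qed.

Lemma canon_id t : canon (canon t) = canon t.
Proof.
elim/rawty_ind': t => //= M s IHM ->; congr RArr.
apply: canon_seq_perm; rewrite perm_sym.
apply: perm_trans (canon_seqP _) _.
rewrite -[X in perm_eq X _]map_id.
rewrite (_ : map id _ = map canon (canon_seq (map canon M))) //.
apply/eq_in_map => u; rewrite -(perm_mem (canon_seqP _)) => /mapP[v vM ->].
by rewrite IHM.
Qed.

Record ty : Type := Ty { rawty_of :> rawty X; _ : canon rawty_of == rawty_of }.

HB.instance Definition _ := [isSub for rawty_of].
HB.instance Definition _ := [Choice of ty by <:].

Definition class_of (t : rawty X) : ty := Ty (introT eqP (canon_id t)).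

Definition tight (c : tight_const) : ty := class_of (RTight X c).
Definition atom (x : X) : ty := class_of (RAtom x).
Definition arr (M : {mset ty}) (s : ty) : ty :=
  class_of (RArr [seq rawty_of t | t <- enum_mset M] s).

Lemma canon_val (t : ty) : canon t = t.
Proof. by case: t => t /= /eqP. Qed.

Lemma tight_inj c1 c2 : tight c1 = tight c2 -> c1 = c2.
Proof. by case. Qed.

Lemma atom_inj x1 x2 : atom x1 = atom x2 -> x1 = x2.
Proof. by case. Qed.

Lemma atom_neq_tight x c : atom x <> tight c.
Proof. by []. Qed.

Lemma arr_neq_tight M s c : arr M s <> tight c.
Proof. by []. Qed.

Lemma arr_neq_atom M s x : arr M s <> atom x.
Proof. by []. Qed.

Lemma map_canon_val (M : seq ty) :
  map canon (map rawty_of M) = map rawty_of M.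
Proof. by rewrite -map_comp; apply: eq_map => t /=; rewrite canon_val. Qed.

Lemma arr_inj M1 s1 M2 s2 : arr M1 s1 = arr M2 s2 -> M1 = M2 /\ s1 = s2.
Proof.
case; rewrite !map_canon_val !canon_val => eM es; split; last exact: val_inj.
rewrite -(seq_mset_id M1) -(seq_mset_id M2); apply/eq_seq_msetP.
apply: (perm_map_inj val_inj); apply: perm_trans (canon_seqP _) _.
by rewrite eM perm_sym canon_seqP.
Qed.

Lemma ty_ind (P : ty -> Prop) :
  (forall c, P (tight c)) -> (forall x, P (atom x)) ->
  (forall (M : {mset ty}) s,
     (forall t, t \in M -> P t) -> P s -> P (arr M s)) ->
  forall t, P t.
Proof.
move=> Pc Px PM t; rewrite (_ : t = class_of t); last first.
  by apply: val_inj; rewrite /= canon_val.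
elim/rawty_ind': {t}(rawty_of t) => // M s IHM IHs.
rewrite (_ : class_of _ = arr (seq_mset (map class_of M)) (class_of s)).
  apply: PM => // t; rewrite (perm_mem (perm_eq_seq_mset _)).
  by case/mapP=> u uM ->; apply: IHM.
apply: val_inj => /=; rewrite canon_id; congr RArr; apply: canon_seq_perm.
rewrite map_canon_val perm_sym.
apply: perm_trans (perm_map _ (perm_eq_seq_mset _)) _.
by rewrite -map_comp.
Qed.

Definition is_tight (t : ty) : Prop := exists c, t = tight c.
Definition mset_tight (M : {mset ty}) : Prop := forall t, t \in M -> is_tight t.

Definition ctx := {fsfun nat -> {mset ty} with mset0}.

Definition ctx0 : ctx := [fsfun].

Definition ctx1 (x : nat) (M : {mset ty}) : ctx := [fsfun ctx0 with x |-> M].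

Definition ctxU (G D : ctx) : ctx :=
  [fsfun x in (finsupp G `|` finsupp D)%fset => G x `+` D x].

(** The context of an abstraction, given the context [G] of its body: index 0
    is dropped and the others are decremented, which is the de Bruijn form of
    resetting the bound variable to the empty multiset. *)
Definition ctx_tail (G : ctx) : ctx :=
  [fsfun x in [fset y.-1 | y in finsupp G] => G x.+1].

Definition ctx_tight (G : ctx) : Prop := forall x, mset_tight (G x).

Lemma ctx0E x : ctx0 x = mset0.
Proof. by rewrite fsfun0E. Qed.

Lemma ctx1E x M y : ctx1 x M y = if y == x then M else mset0.
Proof. by rewrite fsfun_withE ctx0E. Qed.

Lemma ctxUE G D x : ctxU G D x = G x `+` D x.
Proof.
rewrite fsfun_fun in_fsetU; case: ifP => // /norP[xG xD].
by rewrite !fsfun_dflt // msetD0.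
Qed.

Lemma ctx_tailE G x : ctx_tail G x = G x.+1.
Proof.
rewrite fsfun_fun; case: ifPn => // /negP xG.
rewrite fsfun_dflt //; apply/negP => x1G.
by apply: xG; apply/imfsetP; exists x.+1.
Qed.

Lemma ctxUA : associative ctxU.
Proof. by move=> G D E; apply/fsfunP => x; rewrite !ctxUE msetDA. Qed.

Lemma ctxUC : commutative ctxU.
Proof. by move=> G D; apply/fsfunP => x; rewrite !ctxUE msetDC. Qed.

Lemma ctx0U : left_id ctx0 ctxU.
Proof. by move=> G; apply/fsfunP => x; rewrite ctxUE ctx0E mset0D. Qed.

HB.instance Definition _ := Monoid.isComLaw.Build ctx ctx0 ctxU ctxUA ctxUC ctx0U.

(** [typing G b r t s] is the type of derivations of G |-(b,r) t : s, and
    [mtyping G b r t M] the type of those of G |-(b,r) t : M. *)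

Inductive typing : ctx -> int -> int -> term -> ty -> Type :=
| d_ax x s :
    typing (ctx1 x [mset s]) 0%R 0%R (Var x) s
| d_fun_b G b r t s :
    typing G b r t s ->
    typing (ctx_tail G) (b + 1)%R r (Lam t) (arr (G 0) s)
| d_fun_r G b r t c :
    typing G b r t (tight c) -> mset_tight (G 0) ->
    typing (ctx_tail G) b (r + 1)%R (Lam t) (tight tabs)
| d_app_b G D b b' r r' t p M s :
    typing G b r t (arr M s) -> mtyping D b' r' p M ->
    typing (ctxU G D) (b + b' + 1)%R (r + r')%R (App t p) s
| d_app_r G D b b' r r' t p c :
    typing G b r t (tight tneutral) -> typing D b' r' p (tight c) ->
    typing (ctxU G D) (b + b')%R (r + r' + 1)%R (App t p) (tight tneutral)
with mtyping : ctx -> int -> int -> term -> {mset ty} -> Type :=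
| d_many (I : finType) (D : I -> ctx) (b r : I -> int) t (s : I -> ty) :
    0 < #|I| ->
    (forall i, typing (D i) (b i) (r i) t (s i)) ->
    mtyping (\big[ctxU/ctx0]_i D i) (\sum_i b i)%R (\sum_i r i)%R t
           (seq_mset [seq s i | i <- enum I])
| d_none D b r t s :
    typing D b r t s ->
    mtyping D b r t mset0.

Fixpoint garbage_tight G b r t s (d : typing G b r t s) : Prop :=
  match d with
  | d_ax _ _ => True
  | d_fun_b _ _ _ _ _ d1 => garbage_tight d1
  | d_fun_r _ _ _ _ _ d1 _ => garbage_tight d1
  | d_app_b _ _ _ _ _ _ _ _ _ _ d1 d2 =>
      garbage_tight d1 /\ mgarbage_tight d2
  | d_app_r _ _ _ _ _ _ _ _ _ d1 d2 =>
      garbage_tight d1 /\ garbage_tight d2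
  end
with mgarbage_tight G b r t M (d : mtyping G b r t M) : Prop :=
  match d with
  | d_many _ _ _ _ _ _ _ ds => forall i, garbage_tight (ds i)
  | d_none _ _ _ _ s d1 => is_tight s /\ garbage_tight d1
  end.

Definition mx_tight G b r t s (d : typing G b r t s) : Prop :=
  [/\ garbage_tight d, is_tight s & ctx_tight G].

End Types.

(* Main.v *)
Require Import Defs.
From mathcomp Require Import all_boot all_order all_algebra.
From mathcomp Require Import finmap multiset.
From mathcomp Require Import ring.

(** Normal forms have mx-tight derivations with b = 0 and r = |p|, and a step
    with index e expands a derivation of its target into one of its source, with
    b increased by 2 and r by e, keeping the type.  A beta step recovers from a
    derivation of u{x <- q} one of u and one of q for each type in the multiset
    that u assigns to x; this multiset is empty exactly when x is not free in u,
    since (none) keeps the context of its premise.  In an erasing step the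
    argument is normal, so it has a tight derivation, whose r is its size.  Steps
    inside an argument are taken when it is erased or when the head is neutral;
    a neutral term has a tight type in a tight context, so in both cases the
    argument is typed with a tight constant. *)

Section SubjectExpansion.

Set Implicit Arguments.
Unset Strict Implicit.
Unset Printing Implicit Defensive.

Import GRing.Theory.

Local Open Scope mset_scope.
Local Open Scope nat_scope.

Variable X : Type.

Implicit Types (G D E : ctx X) (s : ty X) (l : seq (ty X)) (b r : int).

(** * Multisets, and tightness of contexts *)

Lemma seq_mset_nil (K : choiceType) : seq_mset [::] = mset0 :> {mset K}.
Proof. by rewrite -enum_mset0 seq_mset_id. Qed.

Lemma seq_mset_cat (K : choiceType) (l1 l2 : seq K) :
  seq_mset (l1 ++ l2) = seq_mset l1 `+` seq_mset l2.
Proof. by apply/msetP => x; rewrite msetE2 !mset_seqE count_cat. Qed.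

Lemma msetD_eq0 (K : choiceType) (A B : {mset K}) :
  (A `+` B == mset0) = (A == mset0) && (B == mset0).
Proof.
apply/eqP/andP => [e|[/eqP-> /eqP->]]; last by rewrite mset0D.
have AB x : (A x == 0) && (B x == 0).
  by rewrite -addn_eq0 -msetE2 e mset0E.
by split; apply/eqP/msetP => x; rewrite mset0E; case/andP: (AB x) => /eqP ? /eqP.
Qed.

Lemma mset1_neq0 (K : choiceType) (x : K) : ([mset x] == mset0) = false.
Proof.
by apply/eqP/msetP => /(_ x) /eqP; rewrite msetnE mset0E eqxx.
Qed.

Lemma mset_tight0 : mset_tight (mset0 : {mset ty X}).
Proof. by move=> s; rewrite in_mset0. Qed.

Lemma mset_tightD (M N : {mset ty X}) :
  mset_tight (M `+` N) <-> mset_tight M /\ mset_tight N.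
Proof.
split=> [MN|[tM tN] s]; last by rewrite in_msetD => /orP[/tM|/tN].
by split=> s sM; apply: MN; rewrite in_msetD sM ?orbT.
Qed.

Lemma ctx_tightU G D : ctx_tight (ctxU G D) <-> ctx_tight G /\ ctx_tight D.
Proof.
split=> [GD|[tG tD] x]; last by rewrite ctxUE; apply/mset_tightD.
by split=> x; have := GD x; rewrite ctxUE => /mset_tightD[].
Qed.

Lemma ctx_tight_tail G :
  ctx_tight G <-> mset_tight (G 0) /\ ctx_tight (ctx_tail G).
Proof.
split=> [tG|[tG0 tG] [|x] //]; first by split=> // x; rewrite ctx_tailE.
by rewrite -ctx_tailE.
Qed.

Lemma ctx_tight1 x c : ctx_tight (ctx1 x [mset tight X c]).
Proof.
move=> y; rewrite ctx1E; case: eqP => _; last exact: mset_tight0.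
by move=> s; rewrite in_mset1 => /eqP->; exists c.
Qed.

Lemma ctxU0 G : ctxU G (ctx0 X) = G.
Proof. by rewrite ctxUC ctx0U. Qed.

(** * Derivations as propositions, with lists of typings *)

(** Garbage-tight typability.  The finite families of premises of (many) are
    listed, and (none) is merged with the application rule that uses it. *)
Inductive gtyping : ctx X -> int -> int -> term -> ty X -> Prop :=
| gt_ax x s : gtyping (ctx1 x [mset s]) 0%R 0%R (Var x) s
| gt_fun_b G b r t s :
    gtyping G b r t s ->
    gtyping (ctx_tail G) (b + 1)%R r (Lam t) (arr (G 0) s)
| gt_fun_r G b r t c :
    gtyping G b r t (tight X c) -> mset_tight (G 0) ->
    gtyping (ctx_tail G) b (r + 1)%R (Lam t) (tight X tabs)
| gt_app_many G D b b' r r' t p l s :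
    l != [::] -> gtyping G b r t (arr (seq_mset l) s) -> gtypings D b' r' p l ->
    gtyping (ctxU G D) (b + b' + 1)%R (r + r')%R (App t p) s
| gt_app_none G D b b' r r' t p c s :
    gtyping G b r t (arr mset0 s) -> gtyping D b' r' p (tight X c) ->
    gtyping (ctxU G D) (b + b' + 1)%R (r + r')%R (App t p) s
| gt_app_r G D b b' r r' t p c :
    gtyping G b r t (tight X tneutral) -> gtyping D b' r' p (tight X c) ->
    gtyping (ctxU G D) (b + b')%R (r + r' + 1)%R (App t p) (tight X tneutral)
with gtypings : ctx X -> int -> int -> term -> seq (ty X) -> Prop :=
| gts_nil t : gtypings (ctx0 X) 0%R 0%R t [::]
| gts_cons G D b b' r r' t s l :
    gtyping G b r t s -> gtypings D b' r' t l ->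
    gtypings (ctxU G D) (b + b')%R (r + r')%R t (s :: l).

Scheme gtyping_mind := Minimality for gtyping Sort Prop
with gtypings_mind := Minimality for gtypings Sort Prop.
Combined Scheme gtyping_mutind from gtyping_mind, gtypings_mind.

Lemma gtypings_cat G D b b' r r' t l1 l2 :
  gtypings G b r t l1 -> gtypings D b' r' t l2 ->
  gtypings (ctxU G D) (b + b')%R (r + r')%R t (l1 ++ l2).
Proof.
move=> d1 d2; elim: G b r t l1 / d1 d2 => [t|G E b b1 r r1 t s l d _ IH] d2.
  by rewrite ctx0U !add0r.
by rewrite -ctxUA -!addrA; apply: gts_cons => //; apply: IH.
Qed.

(** * Free variables and shifting *)

Lemma shift_var c x : (if c <= x then x.+1 else x) = bump c x.
Proof. by rewrite /bump; case: ifP. Qed.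

Lemma in_fv_shift c t : in_fv c (shift c t) = false.
Proof.
elim: t c => [x|t IH|t IHt p IHp] c /=; rewrite ?IH ?IHt ?IHp //.
by rewrite shift_var (negbTE (neq_bump _ _)).
Qed.

Lemma gtyping_lam_arr G b r t (M : {mset ty X}) s :
  gtyping G b r (Lam t) (arr M s) ->
  exists G' b',
    [/\ gtyping G' b' r t s, G = ctx_tail G', M = G' 0 & b = (b' + 1)%R].
Proof.
move Et: (Lam t) => t'; move Es: (arr M s) => s' d.
case: _ _ _ _ _ / d Et Es => // {}G {}b {}r {}t' {}s' d [->] /arr_inj[-> ->].
by exists G, b.
Qed.

(** An argument typed by the empty multiset still contributes the context of its tight premise, so
    no free variable is lost. Only an empty list of typings has an empty context whatever the term,
    whence the extra conjunct. *)
Lemma gtyping_fv :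
  (forall G b r t s, gtyping G b r t s ->
     forall x, (G x == mset0) = ~~ in_fv x t) /\
  (forall G b r t l, gtypings G b r t l ->
     forall x, (G x == mset0) = ~~ (in_fv x t && (l != [::]))).
Proof.
apply: gtyping_mutind =>
  [x s y|G b r t s _ IH y|G b r t c _ IH _ y|
   G D b b' r r' t p l s l0 _ IH1 _ IH2 y|G D b b' r r' t p c s _ IH1 _ IH2 y|
   G D b b' r r' t p c _ IH1 _ IH2 y|t y|G D b b' r r' t s l _ IH1 _ IH2 y] /=.
- by rewrite ctx1E; case: (y == x); rewrite ?mset1_neq0 ?eqxx.
- by rewrite ctx_tailE.
- by rewrite ctx_tailE.
- by rewrite ctxUE msetD_eq0 IH1 IH2 l0 andbT negb_or.
- by rewrite ctxUE msetD_eq0 IH1 IH2 negb_or.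
- by rewrite ctxUE msetD_eq0 IH1 IH2 negb_or.
- by rewrite ctx0E eqxx andbF.
- by rewrite ctxUE msetD_eq0 IH1 IH2 /= andbT negb_and; case: in_fv.
Qed.

(** Takes the typings of an argument back out from under the binders below which substitution has
    pushed it; [bump c] skips the index that [shift c t] does not contain. *)
Lemma gtyping_unshift :
  (forall G b r t' s, gtyping G b r t' s -> forall c t, t' = shift c t ->
     exists2 G', gtyping G' b r t s & forall x, G' x = G (bump c x)) /\
  (forall G b r t' l, gtypings G b r t' l -> forall c t, t' = shift c t ->
     exists2 G', gtypings G' b r t l & forall x, G' x = G (bump c x)).
Proof.
apply: gtyping_mutind =>
  [x s|G b r t' s _ IH|G b r t' a _ IH tG|
   G D b b' r r' t' p' l s l0 _ IH1 _ IH2|G D b b' r r' t' p' a s _ IH1 _ IH2|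
   G D b b' r r' t' p' a _ IH1 _ IH2|t'|G D b b' r r' t' s l _ IH1 _ IH2]
  c t.
- case: t => //= y [->]; exists (ctx1 y [mset s]); first exact: gt_ax.
  move=> x'; by rewrite !ctx1E shift_var (can_eq (bumpK c)).
- case: t => //= t [/IH[G' d eG]]; exists (ctx_tail G').
    (* [bump c.+1] fixes 0, so the bound variable keeps its multiset. *)
    rewrite (_ : G 0 = G' 0); last by rewrite eG.
    exact: gt_fun_b.
  by move=> x; rewrite !ctx_tailE eG bumpS.
- case: t => //= t [/IH[G' d eG]]; exists (ctx_tail G').
    by apply: gt_fun_r d _; rewrite eG.
  by move=> x; rewrite !ctx_tailE eG bumpS.
- case: t => //= t p [/IH1[G' d eG] /IH2[D' d' eD]]; exists (ctxU G' D').
    exact: gt_app_many d d'.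
  by move=> x; rewrite !ctxUE eG eD.
- case: t => //= t p [/IH1[G' d eG] /IH2[D' d' eD]]; exists (ctxU G' D').
    exact: gt_app_none d d'.
  by move=> x; rewrite !ctxUE eG eD.
- case: t => //= t p [/IH1[G' d eG] /IH2[D' d' eD]]; exists (ctxU G' D').
    exact: gt_app_r d d'.
  by move=> x; rewrite !ctxUE eG eD.
- by move=> _; exists (ctx0 X); [exact: gts_nil | move=> x; rewrite !ctx0E].
- move=> e; have [G' d eG] := IH1 _ _ e; have [D' d' eD] := IH2 _ _ e.
  exists (ctxU G' D'); first exact: gts_cons d d'.
  by move=> x; rewrite !ctxUE eG eD.
Qed.

(** * Anti-substitution *)

(** [J] stands for the typability of a term [t] at some fixed type: the
    judgement with context [G] and indices [b], [r] splits into one for [t] and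
    one for [q] at the multiset that [t] assigns to index [c]. *)
Definition splits (J : ctx X -> int -> int -> Prop) c q G b r : Prop :=
  exists Gt bt rt D bq rq l,
    [/\ J Gt bt rt, gtypings D bq rq q l, Gt c = seq_mset l,
        forall x, G x = Gt (bump c x) `+` D x
      & b = (bt + bq)%R /\ r = (rt + rq)%R].

(** When nothing is asked of [q], it gets the empty list of types, for which [gts_nil] needs no
    premise, unlike (none). *)
Lemma splits_pure (J : ctx X -> int -> int -> Prop) c q G G' b r :
  J G' b r -> G' c = mset0 -> (forall x, G x = G' (bump c x)) ->
  splits J c q G b r.
Proof.
move=> d G'c eG; exists G', b, r, (ctx0 X), 0%R, 0%R, [::].
rewrite seq_mset_nil !addr0; split=> //; first exact: gts_nil.
by move=> x; rewrite ctx0E msetD0.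
Qed.

(** [i] and [j] are the increments of the last rule, so that one statement serves the three
    application rules and [gts_cons]. *)
Lemma splits_combine (J1 J2 J3 : ctx X -> int -> int -> Prop) c q
    G1 G2 b1 b2 r1 r2 (i j : int) :
  splits J1 c q G1 b1 r1 -> splits J2 c q G2 b2 r2 ->
  (forall G D b b' r r', J1 G b r -> J2 D b' r' ->
     J3 (ctxU G D) (b + b' + i)%R (r + r' + j)%R) ->
  splits J3 c q (ctxU G1 G2) (b1 + b2 + i)%R (r1 + r2 + j)%R.
Proof.
move=> [G [b [r [D [bq [rq [l [d dq eG eGD [-> ->]]]]]]]]].
move=> [G' [b' [r' [D' [bq' [rq' [l' [d' dq' eG' eGD' [-> ->]]]]]]]]] J123.
exists (ctxU G G'), (b + b' + i)%R, (r + r' + j)%R, (ctxU D D').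
exists (bq + bq')%R, (rq + rq')%R, (l ++ l'); split.
- exact: J123.
- exact: gtypings_cat.
- by rewrite ctxUE eG eG' seq_mset_cat.
- by move=> x; rewrite !ctxUE eGD eGD' msetDACA.
- by split; ring.
Qed.

Lemma splits_gtypings c q t :
  (forall G b r s, gtyping G b r (subst c q t) s ->
     splits (fun G b r => gtyping G b r t s) c q G b r) ->
  forall G b r l, gtypings G b r (subst c q t) l ->
     splits (fun G b r => gtypings G b r t l) c q G b r.
Proof.
move=> IH G b r l; move E: (subst c q t) => t' d.
elim: G b r t' l / d E => [t' _|G D b b' r r' t' s l d _ IHl E].
  apply: (@splits_pure _ _ _ _ (ctx0 X)); first exact: gts_nil.
    by rewrite ctx0E.
  by move=> x; rewrite !ctx0E.
(* The zeros are the increments [i] and [j]: [gts_cons] adds no unit. *)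
rewrite -E in d; rewrite -(addr0 (b + b')%R) -(addr0 (r + r')%R).
apply: splits_combine (IH _ _ _ _ d) (IHl E) _ => *.
by rewrite !addr0; apply: gts_cons.
Qed.

Lemma splits_lam (J J' : ctx X -> int -> int -> Prop) c q G b r (i j : int) :
  splits J c.+1 (shift 0 q) G b r ->
  (forall G' b r, J G' b r -> G' 0 = G 0 ->
     J' (ctx_tail G') (b + i)%R (r + j)%R) ->
  splits J' c q (ctx_tail G) (b + i)%R (r + j)%R.
Proof.
move=> [Gt [bt [rt [D [bq [rq [l [d dq eGt eG [-> ->]]]]]]]]] JJ'.
have [D' dq' eD] := gtyping_unshift.2 _ _ _ _ _ dq 0 q erefl.
(* The shifted argument avoids the bound variable, so [G] and [Gt] agree at 0, as the rules for
   abstractions require. *)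
have D0 : D 0 = mset0.
  by apply/eqP; rewrite (gtyping_fv.2 _ _ _ _ _ dq) in_fv_shift.
exists (ctx_tail Gt), (bt + i)%R, (rt + j)%R, D', bq, rq, l; split=> //.
- by apply: JJ' => //; rewrite eG D0 msetD0.
- by rewrite ctx_tailE.
- by move=> x; rewrite !ctx_tailE eG bumpS eD.
- by split; ring.
Qed.

(** The induction is on [t], since the derivation follows [t] only until it reaches a copy of [q].
    Each typing of such a copy contributes one type, and applications concatenate the lists. *)
Lemma gtyping_antisubst t c q G b r s :
  gtyping G b r (subst c q t) s ->
  splits (fun G b r => gtyping G b r t s) c q G b r.
Proof.
elim: t c q G b r s => [x|t IH|t IHt p IHp] c q G b r s /=.
(* A variable [x] other than [c] is [bump c y] for the variable [y] that substitution leaves in its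
   place. *)
- have pure y : bump c y = x -> gtyping G b r (Var y) s ->
      splits (fun G b r => gtyping G b r (Var x) s) c q G b r.
    move=> <-; move E: (Var y) => t' d; case: _ _ _ _ _ / d E => // {}y {}s [->].
    apply: splits_pure; first exact: gt_ax.
      by rewrite ctx1E (negbTE (neq_bump _ _)).
    by move=> x'; rewrite !ctx1E (can_eq (bumpK c)).
  case: ltnP => [xc|cx].
    by apply: pure; rewrite /bump leqNgt xc.
  case: eqP => [->|/eqP xc] d.
    (* The trailing [ctx0 X] and zeros are what [gts_cons] over [gts_nil] produces. *)
    exists (ctx1 c [mset s]), 0%R, 0%R, (ctxU G (ctx0 X)), (b + 0)%R, (r + 0)%R.
    exists [:: s]; split.
    - exact: gt_ax.
    - by apply: gts_cons d _; apply: gts_nil.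
    - by rewrite ctx1E eqxx mset_cons seq_mset_nil msetD0.
    - by move=> y; rewrite ctxU0 ctx1E eq_sym (negbTE (neq_bump _ _)) mset0D.
    - by rewrite !addr0 !add0r.
  apply: pure d; have {cx xc} : c < x by rewrite ltn_neqAle eq_sym xc.
  by case: x => // x; rewrite ltnS /bump => ->.
- move E: (Lam _) => t' d; case: _ _ _ _ _ / d E => // {}G {}b {}r {}t'.
    move=> {}s d [E]; rewrite -E in d; rewrite -(addr0 r).
    apply: splits_lam (IH _ _ _ _ _ _ d) _ => G' b' r' d' <-.
    by rewrite addr0; apply: gt_fun_b.
  move=> a d tG [E]; rewrite -E in d; rewrite -(addr0 b).
  apply: splits_lam (IH _ _ _ _ _ _ d) _ => G' b' r' d' eG.
  by rewrite addr0; apply: gt_fun_r d' _; rewrite eG.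
- move E: (App _ _) => t' d; case: _ _ _ _ _ / d E => // {}G D {}b b' {}r r' {}t'.
  + move=> p' l {}s l0 d1 d2 [E1 E2]; rewrite -E1 in d1; rewrite -E2 in d2.
    rewrite -(addr0 (r + r')%R).
    apply: splits_combine (IHt _ _ _ _ _ _ d1) (splits_gtypings (IHp c q) d2) _.
    by move=> *; rewrite addr0; apply: gt_app_many; eassumption.
  + move=> p' a {}s d1 d2 [E1 E2]; rewrite -E1 in d1; rewrite -E2 in d2.
    rewrite -(addr0 (r + r')%R).
    apply: splits_combine (IHt _ _ _ _ _ _ d1) (IHp _ _ _ _ _ _ d2) _.
    by move=> *; rewrite addr0; apply: gt_app_none; eassumption.
  + move=> p' a d1 d2 [E1 E2]; rewrite -E1 in d1; rewrite -E2 in d2.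
    rewrite -(addr0 (b + b')%R).
    apply: splits_combine (IHt _ _ _ _ _ _ d1) (IHp _ _ _ _ _ _ d2) _.
    by move=> *; rewrite addr0; apply: gt_app_r; eassumption.
Qed.

Lemma gtyping_subst u q G b r s :
  gtyping G b r (subst 0 q u) s ->
  exists Gu bu ru D bq rq l,
    [/\ gtyping Gu bu ru u s, gtypings D bq rq q l, Gu 0 = seq_mset l,
        G = ctxU (ctx_tail Gu) D & b = (bu + bq)%R /\ r = (ru + rq)%R].
Proof.
case/gtyping_antisubst => Gu [bu [ru [D [bq [rq [l [d dq eGu eG eq]]]]]]].
exists Gu, bu, ru, D, bq, rq, l; split=> //.
by apply/fsfunP => x; rewrite eG ctxUE ctx_tailE.
Qed.

(** * Typing neutral and normal terms *)

(** The type of the head variable lies in the context, so it is tight and not an arrow; hence every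
    application along the spine is typed by [gt_app_r]. *)
Lemma gtyping_neutral t : neutral_mx t ->
  forall G b r s, gtyping G b r t s -> ctx_tight G -> is_tight s.
Proof.
elim=> {t} [x|t p _ IH _] G b r s.
  move E: (Var x) => t' d; case: _ _ _ _ _ / d E => // y {}s _ /(_ y).
  by rewrite ctx1E eqxx; apply; rewrite in_mset1.
move E: (App t p) => t' d; case: _ _ _ _ _ / d E => //.
- move=> {}G D {}b b' {}r r' {}t' p' l {}s _ d _ [E _]; rewrite -E in d.
  by case/ctx_tightU => /(IH _ _ _ _ d)[].
- move=> {}G D {}b b' {}r r' {}t' p' c {}s d _ [E _]; rewrite -E in d.
  by case/ctx_tightU => /(IH _ _ _ _ d)[].
- by move=> *; exists tneutral.
Qed.

Scheme neutral_mx_mind := Minimality for neutral_mx Sort Prop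
with normal_mx_mind := Minimality for normal_mx Sort Prop.
Combined Scheme neutral_normal_mutind from neutral_mx_mind, normal_mx_mind.

(** Besides axioms at [tneutral], only [gt_fun_r] and [gt_app_r] are used: each adds one to [r] and
    nothing to [b], just as [size_mx] counts abstractions and applications. *)
Lemma gtyping_normal_form :
  (forall t, neutral_mx t -> exists2 G, ctx_tight G &
     gtyping G 0%R (size_mx t)%:Z%R t (tight X tneutral)) /\
  (forall t, normal_mx t -> exists2 G, ctx_tight G & exists2 c,
     gtyping G 0%R (size_mx t)%:Z%R t (tight X c) &
     [/\ neutral_mx t -> c = tneutral & abs_mx t -> c = tabs]).
Proof.
apply: neutral_normal_mutind => [x|t p _ [G tG d] _ [D tD [c d' _]]|t nt [G tG d]
  |t _ [G tG [c d _]]].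
- exists (ctx1 x [mset tight X tneutral]); first exact: ctx_tight1.
  exact: gt_ax.
- exists (ctxU G D); first by apply/ctx_tightU.
  rewrite -(addr0 0%R) /= -addn1 !PoszD.
  exact: gt_app_r d d'.
- exists G => //; exists tneutral => //; split=> // -[u et].
  by rewrite et in nt; inversion nt.
- case/ctx_tight_tail: (tG) => tG0 tG'.
  exists (ctx_tail G) => //; exists tabs.
    by rewrite /= -addn1 PoszD; apply: gt_fun_r d tG0.
  by split=> // nt; inversion nt.
Qed.

(** * Subject expansion *)

(** The side condition on [s] fails only below the left of an application that
    is not a redex, where [t] is not an abstraction: so an abstraction on the
    path to the redex always has type [tabs]. *)
Lemma gtyping_expansion e t p : step_mx e t p ->
  forall G b r s, gtyping G b r p s -> ctx_tight G -> is_tight s \/ ~ abs_mx t ->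
  exists2 G', ctx_tight G' & gtyping G' (b + 2)%R (r + e)%R t s.
Proof.
elim=> {e t p}
  [u q u0|u q nq u0|e u t p _ IH u0|e t p _ IH|e t p u nt _ IH|e u t p nu _ IH]
  G b r s.
- case/gtyping_subst => Gu [bu [ru [D [bq [rq [l [d dq eGu -> [-> ->]]]]]]]] tG _.
  exists (ctxU (ctx_tail Gu) D) => //.
  have l0 : l != [::].
    apply/eqP => l0; have := gtyping_fv.1 _ _ _ _ _ d 0.
    by rewrite eGu l0 seq_mset_nil eqxx u0.
  (* The two units of [b] are those of [gt_fun_b] and [gt_app_many]. *)
  rewrite (_ : (_ + 2 = bu + 1 + bq + 1)%R); last by ring.
  by rewrite addr0; apply: gt_app_many l0 _ dq; rewrite -eGu; apply: gt_fun_b.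
- case/gtyping_subst => Gu [bu [ru [D [bq [rq [l [d dq eGu -> [-> ->]]]]]]]] tG _.
  have Gu0 : Gu 0 = mset0 by apply/eqP; rewrite (gtyping_fv.1 _ _ _ _ _ d).
  have l0 : l = [::].
    case: l dq eGu => // a l _; rewrite Gu0 mset_cons => /esym/eqP.
    by rewrite msetD_eq0 mset1_neq0.
  move: dq tG; rewrite l0 => dq; inversion dq; subst => /ctx_tightU[tG _].
  (* The typing of the reduct says nothing about [q], so the premise of (none) is built from its
     normal form: [b] is 0 and [r] is the index of the step. *)
  have [E tE [c dE _]] := gtyping_normal_form.2 _ nq.
  exists (ctxU (ctx_tail Gu) E); first by apply/ctx_tightU.
  rewrite (_ : (_ + 2 = bu + 1 + 0 + 1)%R); last by ring.
  by rewrite (addr0 ru); apply: gt_app_none dE; rewrite -Gu0; apply: gt_fun_b.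
- move E: (App _ _) => t' d; case: _ _ _ _ _ / d E => // {}G D {}b b' {}r r' {}t' p'.
  + move=> l {}s l0 d _ [E _]; rewrite -E in d.
    have [G' [b1 [d' _ eM _]]] := gtyping_lam_arr d.
    (* The source of the arrow is the multiset of a variable not free in [u], hence empty, whereas
       [l] is not. *)
    case: l eM l0 {d} => // a l eM _; have := gtyping_fv.1 _ _ _ _ _ d' 0.
    by rewrite -eM u0 mset_cons msetD_eq0 mset1_neq0.
  + move=> c {}s d1 d2 [E1 E2] /ctx_tightU[tG tD] _; rewrite -E2 in d2.
    have [D' tD' d'] := IH _ _ _ _ d2 tD (or_introl (ex_intro _ c erefl)).
    exists (ctxU G D'); first by apply/ctx_tightU.
    rewrite (_ : (_ + 2 = b + (b' + 2) + 1)%R); last by ring.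
    by rewrite -(addrA r); apply: gt_app_none d'; rewrite E1.
  + move=> c d1 _ [E1 _]; rewrite -E1 in d1.
    by move Es: (tight X tneutral) d1 => s' d1; inversion d1; subst.
- move E: (Lam _) => t' d; case: _ _ _ _ _ / d E => // {}G {}b {}r {}t'.
    by move=> s' _ _ _ [[c /arr_neq_tight]|[]] //; exists t.
  move=> c d tG0 [E] tG _; rewrite -E in d.
  have tG' : ctx_tight G by apply/ctx_tight_tail.
  have [G' tG'' d'] := IH _ _ _ _ d tG' (or_introl (ex_intro _ c erefl)).
  case/ctx_tight_tail: (tG'') => tG'0 tG't; exists (ctx_tail G') => //.
  by rewrite addrAC; apply: gt_fun_r d' tG'0.
- move E: (App _ _) => t' d; case: _ _ _ _ _ / d E => // {}G D {}b b' {}r r' {}t' p'.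
  + move=> l {}s l0 d d2 [E E2] /ctx_tightU[tG tD] _; rewrite -E in d; rewrite -E2 in d2.
    have [G' tG' d'] := IH _ _ _ _ d tG (or_intror nt).
    exists (ctxU G' D); first by apply/ctx_tightU.
    rewrite (_ : (_ + 2 = b + 2 + b' + 1)%R); last by ring.
    by rewrite (addrAC r r' e); apply: gt_app_many d' d2.
  + move=> c {}s d d2 [E E2] /ctx_tightU[tG tD] _; rewrite -E in d; rewrite -E2 in d2.
    have [G' tG' d'] := IH _ _ _ _ d tG (or_intror nt).
    exists (ctxU G' D); first by apply/ctx_tightU.
    rewrite (_ : (_ + 2 = b + 2 + b' + 1)%R); last by ring.
    by rewrite (addrAC r r' e); apply: gt_app_none d' d2.
  + move=> c d d2 [E E2] /ctx_tightU[tG tD] _; rewrite -E in d; rewrite -E2 in d2.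
    have [G' tG' d'] := IH _ _ _ _ d tG (or_intror nt).
    exists (ctxU G' D); first by apply/ctx_tightU.
    rewrite (addrAC b b' 2%R) (_ : (_ + e = r + e + r' + 1)%R); last by ring.
    exact: gt_app_r d' d2.
- move E: (App _ _) => t' d; case: _ _ _ _ _ / d E => // {}G D {}b b' {}r r' {}t' p'.
  + move=> l {}s _ d _ [E _] /ctx_tightU[tG _]; rewrite -E in d.
    by have [] := gtyping_neutral nu d tG.
  + move=> c {}s d _ [E _] /ctx_tightU[tG _]; rewrite -E in d.
    by have [] := gtyping_neutral nu d tG.
  + move=> c d d2 [E1 E] /ctx_tightU[tG tD] _; rewrite -E1 in d; rewrite -E in d2.
    have [D' tD' d'] := IH _ _ _ _ d2 tD (or_introl (ex_intro _ c erefl)).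
    exists (ctxU G D'); first by apply/ctx_tightU.
    rewrite -(addrA b b' 2%R) (_ : (_ + e = r + (r' + e) + 1)%R); last by ring.
    exact: gt_app_r d d'.
Qed.

Lemma gtyping_expansions k e t p : steps_mx k e t p ->
  forall G b r c, gtyping G b r p (tight X c) -> ctx_tight G ->
  exists2 G', ctx_tight G' &
    gtyping G' (b + (2 * k)%N%:Z)%R (r + e)%R t (tight X c).
Proof.
elim=> {k e t p} [t|k e1 e2 t p u st _ IH] G b r c d tG.
  by exists G; rewrite // !addr0.
have [G1 tG1 d1] := IH _ _ _ _ d tG.
have [G2 tG2 d2] :=
  gtyping_expansion st d1 tG1 (or_introl (ex_intro _ c erefl)).
exists G2 => //; rewrite (_ : (r + (e1 + e2) = r + e2 + e1)%R); last by ring.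
rewrite (_ : (b + _ = b + (2 * k)%N%:Z + 2)%R) //.
by rewrite mulnS PoszD; ring.
Qed.

(** * Back to derivations of system mx *)

Lemma big_option (T : Type) (op : T -> T -> T) (idx : T) (I : finType)
    (F : option I -> T) :
  \big[op/idx]_i F i = op (F None) (\big[op/idx]_i F (Some i)).
Proof. by rewrite ![index_enum _]unlock [@Finite.enum in LHS]unlock /= big_cons big_map. Qed.

Lemma enum_option (I : finType) : enum {: option I} = None :: map Some (enum I).
Proof. by rewrite !enumT [in LHS]unlock. Qed.

(** The empty list becomes a family over [void], and one more typing extends the index type from [I]
    to [option I]. A nonempty list thus yields the nonempty index type that (many) demands. *)
Lemma gtyping_sound :
  (forall G b r t s, gtyping G b r t s ->
     exists d : typing G b r t s, garbage_tight d) /\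
  (forall G b r t l, gtypings G b r t l ->
     exists (I : finType) (D : I -> ctx X) (bi ri : I -> int) (si : I -> ty X)
            (ds : forall i, typing (D i) (bi i) (ri i) t (si i)),
       [/\ forall i, garbage_tight (ds i), G = \big[@ctxU X/ctx0 X]_i D i,
           b = (\sum_i bi i)%R, r = (\sum_i ri i)%R
         & l = [seq si i | i <- enum I]]).
Proof.
apply: gtyping_mutind =>
  [x s|G b r t s _ [d gd]|G b r t c _ [d gd] tG|
   G D b b' r r' t p l s l0 _ [d gd] _ [I [Di [bi [ri [si [ds [gds -> -> -> el]]]]]]]|
   G D b b' r r' t p c s _ [d gd] _ [d' gd']|
   G D b b' r r' t p c _ [d gd] _ [d' gd']|t|
   G D b b' r r' t s l _ [d gd] _ [I [Di [bi [ri [si [ds [gds -> -> -> ->]]]]]]]].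
- by exists (d_ax x s).
- by exists (d_fun_b d).
- by exists (d_fun_r d tG).
- have I0 : 0 < #|I|.
    by rewrite cardE lt0n size_eq0; apply: contra l0; rewrite el => /eqP->.
  by rewrite el in d gd *; exists (d_app_b d (d_many I0 ds)).
- by exists (d_app_b d (d_none d')); do ?split=> //; exists c.
- by exists (d_app_r d d').
- exists void, (fun=> ctx0 X), (fun=> 0%R), (fun=> 0%R), (fun=> tight X tabs).
  exists (fun i : void => match i with end); split; try by case.
  + by rewrite big1.
  + by rewrite big1.
  + by rewrite big1.
  + by case: (enum _) => // -[].
- pose D' o := if o is Some i then Di i else G.
  pose bo o := if o is Some i then bi i else b.
  pose ro o := if o is Some i then ri i else r.
  pose so o := if o is Some i then si i else s.
  pose dso o : typing (D' o) (bo o) (ro o) t (so o) :=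
    match o with Some i => ds i | None => d end.
  exists (option I), D', bo, ro, so, dso.
  rewrite !big_option enum_option /= -map_comp; split=> //.
  by case.
Qed.

End SubjectExpansion.

Theorem theorem5p11 (X : Type) (X_nonempty : inhabited X)
    (t p : term) (k : nat) (e : int) :
  steps_mx k e t p -> normal_mx p ->
  exists (G : ctx X) (s : ty X)
         (d : typing G (2 * k)%N%:Z%R ((size_mx p)%:Z + e)%R t s),
    [/\ mx_tight d,
        neutral_mx p -> s = tight X tneutral
      & abs_mx p -> s = tight X tabs].
Proof.
move=> tp np; have [D tD [c dp [cn ca]]] := (gtyping_normal_form X).2 _ np.
(* Expansion keeps the constant [c], so what the shape of [p] says about [c] holds for the type of
   [t]. *)
have [G tG dt] := gtyping_expansions tp dp tD.
rewrite GRing.add0r in dt; have [d gd] := (gtyping_sound X).1 _ _ _ _ _ dt.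
exists G, (tight X c), d; split=> [|/cn->|/ca->] //.
by split=> //; exists c.
Qed.
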